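(* Let $B_1,\dots,B_m$ be finite sets, put $\Omega=\bigcup_iB_i$, and for $x\in\Omega$ let $a_x=|\{i:x\in B_i\}|$. For $0\le t\le m$, there are $t$ distinct indices whose sets $B_i$ have union of size at least $$\left\lceil\sum_{x\in\Omega}\left(1-\frac{\binom{m-a_x}{t}}{\binom mt}\right)\right\rceil.$$ Such a selection can be obtained using integer scores, by choosing the $t$ indices one at a time without replacement as follows: at a stage with $M$ indices remaining and $h$ choices still to make, let $U$ be the union of the sets chosen so far and, for $x\notin U$, let $a_x$ now denote the number of remaining indices $i$ with $x\in B_i$; choose a remaining index $i$ maximizing $$\sum_{x\in B_i\setminus U}\binom{M-1-a_x}{h-1}.$$ Here a binomial coefficient is zero if its upper index is negative or smaller than its lower index. *)

(* Defs.v *)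
From mathcomp Require Export all_boot all_order all_algebra finmap.

Set Implicit Arguments.
Unset Strict Implicit.
Unset Printing Implicit Defensive.

Import GRing.Theory Num.Theory.

(* The upper index is an integer: at a stage with M remaining indices, an
   element of all M remaining sets has upper index M - 1 - M = -1 and must
   contribute 0, whereas truncated subtraction would give 'C(0, 0) = 1 when
   one choice is left. *)
Definition zbin (n : int) (k : nat) : nat :=
  if n is Posz n' then 'C(n', k) else 0.

Section Cover.

Variables (K : choiceType) (m : nat) (B : 'I_m -> {fset K}).

Definition union_of (I : {set 'I_m}) : {fset K} := (\bigcup_(i in I) B i)%fset.

Definition multiplicity (I : {set 'I_m}) (x : K) : nat :=
  #|[set i in I | x \in B i]|.

(* A state of the procedure is the sequence s of the indices chosen so far,
   in order of choice. *)
Definition chosen (s : seq 'I_m) : {set 'I_m} := [set i in s].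

Definition remaining (s : seq 'I_m) : {set 'I_m} := ~: chosen s.

Definition score (t : nat) (s : seq 'I_m) (i : 'I_m) : nat :=
  let M := #|remaining s| in
  let h := t - size s in
  \sum_(x <- (B i `\` union_of (chosen s))%fset)
    zbin (M%:Z - 1 - (multiplicity (remaining s) x)%:Z)%R (h - 1).

Definition maximizes_score (t : nat) (s : seq 'I_m) (i : 'I_m) : Prop :=
  i \in remaining s /\
  (forall j, j \in remaining s -> score t s j <= score t s i).

(* Ties between maximizers may be broken arbitrarily. *)
Inductive greedy_run (t : nat) : seq 'I_m -> Prop :=
| greedy_start : greedy_run t [::]
| greedy_step s i : greedy_run t s -> size s < t -> maximizes_score t s i ->
    greedy_run t (rcons s i).

Definition coverage_bound (t : nat) : int :=
  Num.ceil (\sum_(x <- union_of [set: 'I_m])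
    (1 - 'C(m - multiplicity [set: 'I_m] x, t)%:R / 'C(m, t)%:R) : rat)%R.

End Cover.

(* Main.v *)
Require Import Defs.
From mathcomp Require Import all_boot all_order all_algebra finmap.
From mathcomp Require Import zify.

Set Implicit Arguments.
Unset Strict Implicit.
Unset Printing Implicit Defensive.

Import GRing.Theory Num.Theory.

(** Method of conditional expectations.  If the remaining [h] indices were
    drawn uniformly among the [M] available ones, an uncovered [x] would stay
    uncovered with probability ['C(M - a_x, h) / 'C(M, h)].  The score of [i]
    is what the choice of [i] removes from a total independent of [i], so a
    maximal score minimizes the conditional expectation of the number of
    points left uncovered; its minimum over [i] is at most its mean over [i],
    hence this expectation never increases along a greedy run. *)

Section Potential.

Variables (K : choiceType) (m : nat) (B : 'I_m -> {fset K}) (t : nat).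

Implicit Types (s : seq 'I_m) (i : 'I_m) (x : K).

Local Notation Omega := (union_of B [set: 'I_m]).

Lemma in_union_of (I : {set 'I_m}) x :
  (x \in union_of B I) = [exists i in I, x \in B i].
Proof.
apply/bigfcupP/exists_inP => [[i /andP[_ iI] xBi]|[i iI xBi]]; exists i => //.
by rewrite mem_index_enum.
Qed.

Lemma union_of_sub (I : {set 'I_m}) : (union_of B I `<=` Omega)%fset.
Proof.
apply/fsubsetP => x; rewrite !in_union_of => /exists_inP[i _ xBi].
by apply/exists_inP; exists i => //; rewrite inE.
Qed.

Lemma chosen_rcons s i : chosen (rcons s i) = i |: chosen s.
Proof. by apply/setP => j; rewrite !inE mem_rcons inE. Qed.

Lemma remaining_rcons s i : remaining (rcons s i) = remaining s :\ i.
Proof. by rewrite /remaining chosen_rcons setCU setIC setDE. Qed.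

Lemma card_chosen s : uniq s -> #|chosen s| = size s.
Proof. by rewrite /chosen cardsE => /card_uniqP. Qed.

Lemma card_remaining s : uniq s -> #|remaining s| = m - size s.
Proof. by move=> us; rewrite cardsCs setCK card_ord card_chosen. Qed.

Lemma in_union_of_rcons s i x :
  (x \in union_of B (chosen (rcons s i))) =
  (x \in B i) || (x \in union_of B (chosen s)).
Proof.
rewrite !in_union_of chosen_rcons; apply/exists_inP/orP.
  move=> [j]; rewrite in_setU1 => /predU1P[->|js] xBj; first by left.
  by right; apply/exists_inP; exists j.
move=> [xBi|/exists_inP[j js xBj]]; first by exists i; rewrite // setU11.
by exists j; rewrite // setU1r.
Qed.

Lemma multiplicity_setD1 (I : {set 'I_m}) i x :
  x \notin B i -> multiplicity B (I :\ i) x = multiplicity B I x.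
Proof.
move=> xNBi; apply: eq_card => j; rewrite !inE.
by case: eqVneq => [->|]; rewrite //= (negPf xNBi) andbF.
Qed.

Lemma card_setI_avoid (I : {set 'I_m}) x :
  #|[set i in I | x \notin B i]| = #|I| - multiplicity B I x.
Proof.
rewrite /multiplicity -(cardsID [set i | x \in B i] I).
have -> : I :&: [set i | x \in B i] = [set i in I | x \in B i].
  by apply/setP => i; rewrite !inE.
by rewrite addKn; apply: eq_card => i; rewrite !inE andbC.
Qed.

Lemma big_fset_sub (A C : {fset K}) (F : K -> nat) : (A `<=` C)%fset ->
  \sum_(x <- A) F x = \sum_(x <- C | x \in A) F x.
Proof.
move=> /fsubsetP AC; rewrite -[RHS]big_filter; apply: perm_big.
apply: uniq_perm; rewrite ?filter_uniq ?fset_uniq // => x.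
by rewrite mem_filter; apply/idP/andP => [xA|[]//]; split=> //; apply: AC.
Qed.

(* ['C(#|remaining s|, t - size s)] times the conditional expectation of the
   number of points finally left uncovered. *)
Definition potential s : nat :=
  \sum_(x <- Omega | x \notin union_of B (chosen s))
    'C(#|remaining s| - multiplicity B (remaining s) x, t - size s).

(** The term that an uncovered [x] contributes to the score of each remaining index whose set
    contains it; it does not depend on that index. *)
Definition score_weight s x : nat :=
  zbin (#|remaining s|%:Z - 1 - (multiplicity B (remaining s) x)%:Z)%R
    (t - size s - 1).

Definition score_total s : nat :=
  \sum_(x <- Omega | x \notin union_of B (chosen s)) score_weight s x.

(** The index [i] misses [x], so fewer than all remaining sets contain [x]: the integer upper index
    is nonnegative and natural subtraction loses nothing. *)
Lemma score_weightE s i x : i \in remaining s -> x \notin B i ->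
  score_weight s x =
  'C((#|remaining s| - multiplicity B (remaining s) x).-1, t - size s - 1).
Proof.
move=> ir xNBi; rewrite /score_weight.
have : 0 < #|[set j in remaining s | x \notin B j]|.
  by apply/card_gt0P; exists i; rewrite inE ir.
rewrite card_setI_avoid.
set M := #|_|; set a := multiplicity _ _ _ => lt_aM.
by have -> : (M%:Z - 1 - a%:Z = ((M - a).-1)%:Z)%R by lia.
Qed.

Lemma potential_rcons s i : i \in remaining s ->
  potential (rcons s i) =
  \sum_(x <- Omega | (x \notin union_of B (chosen s)) && (x \notin B i))
    score_weight s x.
Proof.
move=> ir; rewrite /potential.
apply: eq_big => [x|x]; first by rewrite in_union_of_rcons negb_or andbC.
rewrite in_union_of_rcons negb_or => /andP[xNBi _].
rewrite (score_weightE ir xNBi) remaining_rcons multiplicity_setD1 //.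
rewrite (cardsD1 i (remaining s)) ir size_rcons.
by rewrite -subnDA addn1 add1n -[in RHS]subn1 -subnDA addn1 subSS.
Qed.

(** The weight of an uncovered point goes to the score if the point lies in [B i], and otherwise to
    the next potential. *)
Lemma score_potential s i : i \in remaining s ->
  score B t s i + potential (rcons s i) = score_total s.
Proof.
move=> ir; rewrite potential_rcons // /score_total [RHS](bigID (mem (B i))) /=.
congr (_ + _); rewrite /score (@big_fset_sub _ Omega).
  by apply: eq_bigl => x; rewrite in_fsetD.
apply/fsubsetP => x; rewrite in_fsetD => /andP[_ xBi].
by rewrite in_union_of; apply/exists_inP; exists i; rewrite ?inE.
Qed.

(** Double counting: an uncovered [x] contributes its weight once for each of the [M - a] remaining
    indices that miss it, and [(M - a) * 'C(M - a - 1, h - 1) = h * 'C(M - a, h)]. *)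
Lemma sum_potential_rcons s : size s < t ->
  \sum_(i in remaining s) potential (rcons s i) = (t - size s) * potential s.
Proof.
move=> lt_st; under eq_bigr => i ir do rewrite potential_rcons // big_mkcondr.
rewrite exchange_big big_distrr /=; apply: eq_bigr => x _; rewrite -big_mkcondr.
rewrite (eq_bigr (fun=> 'C((#|remaining s| - multiplicity B (remaining s) x).-1,
  t - size s - 1))) => [|i /andP[ir xNBi]]; last exact: score_weightE ir xNBi.
rewrite (eq_bigl (mem [set i in remaining s | x \notin B i])) => [|i];
  last by rewrite !inE.
rewrite sum_nat_const card_setI_avoid mul_bin_diag.
by rewrite subn1 prednK // subn_gt0.
Qed.

Lemma greedy_run_uniq s : greedy_run B t s -> uniq s.
Proof.
elim=> // {}s i _ us _ [ir _]; rewrite rcons_uniq us andbT.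
by move: ir; rewrite !inE.
Qed.

Lemma greedy_run_size s : greedy_run B t s -> size s <= t.
Proof. by case=> // {}s i _ lt_st _; rewrite size_rcons. Qed.

(** Score and next potential have a constant sum, so a maximizer has the least next potential, which
    is at most the mean. *)
Lemma potential_greedy_step s i : size s < t -> maximizes_score B t s i ->
  #|remaining s| * potential (rcons s i) <= (t - size s) * potential s.
Proof.
move=> lt_st [ir maxi]; rewrite -sum_potential_rcons // -sum_nat_const.
apply: leq_sum => j jr; have := maxi j jr.
by have := score_potential ir; rewrite -(score_potential jr); lia.
Qed.

(** Cross-multiplied form of the fact that the conditional expectation never exceeds its initial
    value. *)
Lemma potential_greedy_run s : t <= m -> greedy_run B t s ->
  potential s * 'C(m, t) <= potential [::] * 'C(m - size s, t - size s).
Proof.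
move=> le_tm; elim=> [|{}s i gs IHs lt_st maxi]; first by rewrite !subn0.
have := potential_greedy_step lt_st maxi.
rewrite card_remaining ?(greedy_run_uniq gs) // size_rcons.
have M_gt0 : 0 < m - size s by lia.
(* The identity [M * 'C(M - 1, h - 1) = h * 'C(M, h)] absorbs the factor [h / M] lost in one
   step. *)
have := mul_bin_diag (m - size s) (t - size s).-1.
rewrite prednK ?subn_gt0 // !subnS => binE step.
rewrite -(leq_pmul2l M_gt0) [leqRHS]mulnCA binE mulnA.
apply: leq_trans (leq_mul step (leqnn _)) _.
by rewrite -mulnA [leqRHS]mulnCA leq_mul.
Qed.

(** While fewer than [t <= m] indices are chosen, some index remains, so a maximizer exists. *)
Lemma greedy_run_extend s : t <= m -> greedy_run B t s ->
  exists2 s', prefix s s' & greedy_run B t s' /\ size s' = t.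
Proof.
move=> le_tm; have [n] := ubnP (t - size s).
elim: n s => // n IHn s lt_n gs.
have [eq_st|lt_st] : size s = t \/ size s < t.
  by have := greedy_run_size gs; rewrite leq_eqVlt => /predU1P.
  by exists s; rewrite ?prefix_refl.
have /card_gt0P[i0 i0r] : 0 < #|remaining s|.
  by rewrite card_remaining ?(greedy_run_uniq gs) // subn_gt0; lia.
case: (@arg_maxnP _ i0 (mem (remaining s)) (score B t s) i0r) => i ir maxi.
have [||s' ss' gs'] := IHn (rcons s i).
- by rewrite size_rcons; lia.
- exact: greedy_step.
by exists s' => //; apply: prefix_trans ss'; apply: prefix_rcons.
Qed.

(** With no choice left, every uncovered point counts ['C(_, 0) = 1]. *)
Lemma potential_full s : size s = t ->
  potential s + #|` union_of B (chosen s)| = #|` Omega|.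
Proof.
move=> st; rewrite /potential st subnn.
under eq_bigr do rewrite bin0.
rewrite -(cardfsID (union_of B (chosen s)) Omega) addnC.
rewrite (fsetIidPr (union_of_sub _)); congr (_ + _).
rewrite card_fset_sum1 (big_fset_sub _ (fsubsetDl _ _)).
rewrite big_seq_cond [RHS]big_seq_cond; apply: eq_bigl => x.
by rewrite in_fsetD; case: (x \in Omega); rewrite ?andbT.
Qed.

Lemma potential_nil :
  potential [::] = \sum_(x <- Omega) 'C(m - multiplicity B [set: 'I_m] x, t).
Proof.
have chosen0 : chosen (Nil 'I_m) = set0 by apply/setP => i; rewrite !inE.
rewrite /potential /remaining chosen0 setC0 cardsT card_ord subn0.
apply: eq_bigl => x; rewrite in_union_of.
by apply/negP => /exists_inP[i]; rewrite inE.
Qed.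

Lemma coverage_bound_le (I : {set 'I_m}) : t <= m ->
  (#|` Omega| - #|` union_of B I|) * 'C(m, t) <= potential [::] ->
  (coverage_bound B t <= #|` union_of B I|%:Z)%R.
Proof.
move=> le_tm; rewrite potential_nil => le_uncovered.
have C_gt0 : (0 < 'C(m, t)%:R :> rat)%R by rewrite ltr0n bin_gt0.
(* An integer bounds the ceiling as soon as it bounds the sum, which is [#|Omega|] minus the initial
   potential over ['C(m, t)]. *)
rewrite /coverage_bound ceil_le_int big_split /= sumrN -mulr_suml -!natr_sum.
rewrite big_const_seq count_predT iter_addr_0 lerBlDr.
rewrite addrC -lerBlDr ler_pdivlMr //.
rewrite -natrB ?fsubset_leq_card ?union_of_sub // -natrM ler_nat.
exact: le_uncovered.
Qed.

End Potential.

Theorem proposition8p3 (K : choiceType) (m : nat) (B : 'I_m -> {fset K})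
    (t : nat) (le_t_m : t <= m) :
  [/\ exists I : {set 'I_m},
        #|I| = t /\ (coverage_bound B t <= #|` union_of B I|%:Z)%R,
      forall s : seq 'I_m, greedy_run B t s ->
        exists2 s' : seq 'I_m,
          prefix s s' & greedy_run B t s' /\ size s' = t
    & forall s : seq 'I_m, greedy_run B t s -> size s = t ->
        #|chosen s| = t /\
        (coverage_bound B t <= #|` union_of B (chosen s)|%:Z)%R].
Proof.
have covers s : greedy_run B t s -> size s = t -> #|chosen s| = t /\
    (coverage_bound B t <= #|` union_of B (chosen s)|%:Z)%R.
  move=> gs st; rewrite card_chosen ?(greedy_run_uniq gs) //; split=> //.
  apply: coverage_bound_le => //; rewrite -(potential_full B st) addnK.
  (* At full length the binomial on the right is ['C(m - t, 0) = 1]. *)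
  by have := potential_greedy_run le_t_m gs; rewrite st subnn bin0 muln1.
split=> // [|s gs]; last exact: greedy_run_extend.
have [s _ [gs st]] := greedy_run_extend le_t_m (greedy_start B t).
by exists (chosen s); apply: covers.
Qed.
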